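(* Let $\varphi$ be a strictly positive real-valued function on $\mathscr{X}$, and for $1\le t\le n$ let $a_t=\min_{\mathbf{x}\in\mathscr{Z}_t}\varphi(\mathbf{x})$, $b_t=\max_{\mathbf{x}\in\mathscr{Z}_t}\varphi(\mathbf{x})$ and $\underline{r}_t=\min\{r_t,1-r_t\}$. Let $\widehat{\mu}_t$ and $\widehat{\nu}_t$ be the sampling distributions of the independent stratified splitting algorithm (ISSA) at steps $1\le t\le n$, for $\mathcal{X}_t$ and $\mathcal{Z}_t$, respectively. Then the ISSA gives an $(\varepsilon,\delta)$-approximation to $z=\mathbb{E}_f[\varphi(\mathbf{X})]$, i.e. its output $\widehat{Z}$ satisfies $$\mathbb{P}\big(z(1-\varepsilon)\le\widehat{Z}\le z(1+\varepsilon)\big)\ge1-\delta,$$ provided that for all $1\le t\le n$ both of the following hold. 1. $$\|\widehat{\mu}_t-\mu_t\|_{\mathrm{TV}}\le\frac{\varepsilon\,\underline{r}_t}{32n}\quad\text{and}\quad|\mathcal{X}_t|\ge\frac{3072\,n^2\ln(4n^2/\delta)}{\varepsilon^2\,\underline{r}_t^2}.$$ 2. $$\|\widehat{\nu}_t-\nu_t\|_{\mathrm{TV}}\le\frac{\varepsilon\,a_t}{16(b_t-a_t)}\quad\text{and}\quad|\mathcal{Z}_t|\ge\frac{128(b_t-a_t)^2\ln(4n/\delta)}{\varepsilon^2a_t^2}.$$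
   Context: Let $\varepsilon,\delta\in(0,1)$. Let $\mathbf{X}\sim f$ be a random variable with values in $\mathscr{X}\subseteq\mathbb{R}^d$, $f$ a probability density with respect to the Lebesgue or counting measure. Let $\mathscr{X}=\mathscr{X}_0\supseteq\cdots\supseteq\mathscr{X}_n=\emptyset$ and $\mathscr{Z}_t=\mathscr{X}_{t-1}\setminus\mathscr{X}_t$, $1\le t\le n$ (a partition of $\mathscr{X}$), with all the conditioning events below of positive probability. Let $\mu_t$ be the conditional distribution of $\mathbf{X}$ given $\mathbf{X}\in\mathscr{X}_{t-1}$ and $\nu_t$ the conditional distribution of $\mathbf{X}$ given $\mathbf{X}\in\mathscr{Z}_t$. Put $r_0=1$ and $r_t=\mathbb{P}_f(\mathbf{X}\in\mathscr{X}_t\mid\mathbf{X}\in\mathscr{X}_{t-1})$ for $1\le t\le n$. The total variation distance is $\|\alpha-\beta\|_{\mathrm{TV}}=\sup_A|\alpha(A)-\beta(A)|$ over measurable sets $A$. **ISSA.** This is the variant of the stratified splitting algorithm in which (by using multiple independent runs) the samples at each step are independent. At each step $t=1,\dots,n$ it produces a multi-set $\mathcal{X}_t$ of independent samples in $\mathscr{X}_{t-1}$ with common distribution $\widehat{\mu}_t$ (obtained by an MCMC kernel with stationary distribution $\mu_t$). The multi-set $\mathcal{Z}_t$ consists of the samples of $\mathcal{X}_t$ lying in $\mathscr{Z}_t$; its elements are regarded as independent samples with common distribution $\widehat{\nu}_t$ on $\mathscr{Z}_t$. Set $\mathcal{Y}_t=\mathcal{X}_t\setminus\mathcal{Z}_t$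 (the samples of $\mathcal{X}_t$ lying in $\mathscr{X}_t$), $\widehat{R}_0=1$, $\widehat{R}_t=|\mathcal{Y}_t|/|\mathcal{X}_t|$, $\widehat{P}_t=(1-\widehat{R}_t)\prod_{j=0}^{t-1}\widehat{R}_j$, $\widehat{\Phi}_t=\frac1{|\mathcal{Z}_t|}\sum_{\mathbf{X}\in\mathcal{Z}_t}\varphi(\mathbf{X})$ and $\widehat{Z}_t=\widehat{\Phi}_t\widehat{P}_t$. The output is $\widehat{Z}=\sum_{t=1}^n\widehat{Z}_t$. *)

(* Defs.v *)
(* MathComp-Analysis. R^d is [d.-tuple R] with the product sigma-algebra of the
   library, i.e. the Borel sets. *)
From HB Require Import structures.
From mathcomp Require Export all_boot all_order all_algebra.
From mathcomp Require Export all_classical all_reals all_analysis.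

Set Implicit Arguments.
Unset Strict Implicit.
Unset Printing Implicit Defensive.

Import Order.TTheory GRing.Theory Num.Theory.
Import numFieldNormedType.Exports.

Local Open Scope classical_set_scope.
Local Open Scope ring_scope.

(* The values on closed boxes determine a measure on the product sigma-algebra,
   so this singles out Lebesgue measure on R^d. *)
Definition is_lebesgue (R : realType) (d : nat)
    (m : {measure set (d.-tuple R) -> \bar R}) : Prop :=
  forall u v : 'I_d -> R, (forall i, u i <= v i) ->
    m [set x | forall i, u i <= tnth x i <= v i] = (\prod_(i < d) (v i - u i))%:E.

Definition is_counting (R : realType) (d : nat)
    (m : {measure set (d.-tuple R) -> \bar R}) : Prop :=
  forall A, measurable A -> m A = counting A.

Definition is_minimum (R : realType) (E : set R) (x : R) : Prop :=
  E x /\ lbound E x.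

Definition is_maximum (R : realType) (E : set R) (x : R) : Prop :=
  E x /\ ubound E x.

Section conditioning.
Context (dW dT : measure_display) (W : measurableType dW)
  (T : measurableType dT) (R : realType) (P : probability W R).

Definition has_density (X : {RV P >-> T}) (m : {measure set T -> \bar R})
    (f : T -> R) : Prop :=
  [/\ measurable_fun setT f, (forall x, 0 <= f x) &
      forall A, measurable A ->
        distribution P X A = (\int[m]_(x in A) (f x)%:E)%E].

(* A |-> P(X \in A | X \in B) *)
Definition cond_law (X : {RV P >-> T}) (B A : set T) : R :=
  fine (distribution P X (A `&` B)) / fine (distribution P X B).

Definition tv_dist (alpha beta : set T -> R) : R :=
  sup [set `|alpha A - beta A| | A in measurable].

End conditioning.

Section samples.
Context (dW dT : measure_display) (W : measurableType dW)
  (T : measurableType dT) (R : realType) (P : probability W R) (N : nat).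

(* Since some of the A i may be the whole space, this yields both the marginal
   laws and the product rule for every subfamily. *)
Definition iid_sample (x : 'I_N -> {RV P >-> T}) (mu : set T -> \bar R) : Prop :=
  forall A : 'I_N -> set T, (forall i, measurable (A i)) ->
    P (\bigcap_(i in [set: 'I_N]) (x i @^-1` A i)) = (\prod_(i < N) mu (A i))%E.

Definition hits (B : set T) (x : 'I_N -> {RV P >-> T}) (w : W) : {set 'I_N} :=
  finset (fun i => x i w \in B).

(* The sub-multi-set of the samples lying in B has random size. That its
   elements are independent with common law nu is understood conditionally on
   the set S of the indices of the samples that lie in B. *)
Definition iid_hits (B : set T) (x : 'I_N -> {RV P >-> T})
    (nu : set T -> \bar R) : Prop :=
  forall (S : {set 'I_N}) (A : 'I_N -> set T), (forall i, measurable (A i)) ->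
    P ([set w | hits B x w = S] `&` \bigcap_(i in [set` S]) (x i @^-1` A i))
    = (P [set w | hits B x w = S] * \prod_(i in S) nu (A i))%E.

End samples.

(* Z_t = X_(t-1) \ X_t, for t >= 1 *)
Definition layer (T : Type) (XX : nat -> set T) (t : nat) : set T :=
  XX t.-1 `\` XX t.

Section stages.
Context (dW dT : measure_display) (W : measurableType dW)
  (T : measurableType dT) (R : realType) (P : probability W R).
Context (X : {RV P >-> T}) (XX : nat -> set T).

(* At t = 0 this is P(X \in X_0 | X \in X_0). *)
Definition stage_prob (t : nat) : R := cond_law X (XX t.-1) (XX t).

Definition stage_min (t : nat) : R :=
  Num.min (stage_prob t) (1 - stage_prob t).

End stages.

Section algorithm.
Context (dW dT : measure_display) (W : measurableType dW)
  (T : measurableType dT) (R : realType) (P : probability W R).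
Context (phi : T -> R) (XX : nat -> set T) (N : nat -> nat)
  (x : forall t : nat, 'I_(N t) -> {RV P >-> T}).

Definition layer_hits (t : nat) (w : W) : {set 'I_(N t)} :=
  hits (layer XX t) (@x t) w.

Definition Rhat (t : nat) (w : W) : R :=
  if t == 0%N then 1 else #|~: layer_hits t w|%:R / (N t)%:R.

Definition Phat (t : nat) (w : W) : R :=
  (1 - Rhat t w) * \prod_(0 <= j < t) Rhat j w.

(* When no sample lies in the layer, this is 0 by the convention 0^-1 = 0; the
   value is immaterial, since then Rhat t w = 1 and Phat t w = 0 (if N t > 0). *)
Definition Phihat (t : nat) (w : W) : R :=
  #|layer_hits t w|%:R^-1 * \sum_(i in layer_hits t w) phi (@x t i w).

Definition issa_output (n : nat) (w : W) : R :=
  \sum_(1 <= t < n.+1) Phihat t w * Phat t w.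

End algorithm.

(* Main.v *)
(**
Each estimated factor is shown to be accurate up to a small relative error off
a set of probability at most [delta / (2 n)], so that a union bound over the
[2 n] estimators leaves probability at least [1 - delta]; the relative errors
are then multiplied along each stratum and summed.

For [Rhat t], a mean of indicators, and for [Phihat t], a mean of [a t, b t]-valued
variables conditionally on the set of samples that hit the layer, the bias is
controlled by the total variation distance and the fluctuation by a Chernoff
bound. Since independence is given as a product rule on measurable sets,
[phi] is first rounded to finitely many values on the layer: this turns the
exponential moment computation into a finite sum, and the rounding error is
absorbed by the slack in the constants. Chernoff's bound with the crude estimate
[exp u <= 1 + u + u ^ 2] suffices for the same reason.
*)
Require Import Defs.
From HB Require Import structures.
From mathcomp Require Import all_boot all_order all_algebra.
From mathcomp Require Import all_classical all_reals all_analysis.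
From mathcomp Require Import measurable_realfun.
From mathcomp Require Import ring lra.

Set Implicit Arguments.
Unset Strict Implicit.
Unset Printing Implicit Defensive.

Import Order.TTheory GRing.Theory Num.Theory.
Import numFieldNormedType.Exports.

Local Open Scope classical_set_scope.
Local Open Scope ring_scope.

(** * Chernoff bound for product laws on a finite set *)

Lemma expR_le_quad (R : realType) (u : R) :
  `|u| <= 1/2 -> expR u <= 1 + u + u ^+ 2.
Proof.
rewrite ler_norml => /andP[u1 u2].
have q0 : 0 < 1 - u / 4 by lra.
(* [exp u = exp (u / 4) ^ 4 <= (1 - u / 4) ^ -4]; the exponent 4 is large enough
   for the polynomial inequality [1 <= (1 + u + u ^ 2) (1 - u / 4) ^ 4]. *)
have h : expR (u / 4) <= (1 - u / 4)^-1.
  rewrite -[u / 4]opprK expRN opprK lef_pV2 ?posrE ?expR_gt0//.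
  by apply: le_trans (expR_ge1Dx _); lra.
have -> : expR u = expR (u / 4) ^+ 4 by rewrite -expRM_natl; congr expR; field.
apply: (@le_trans _ _ ((1 - u / 4)^-1 ^+ 4)).
  by apply: lerXn2r => //; rewrite nnegrE ?expR_ge0// invr_ge0 ltW.
rewrite exprVn -[X in X <= _]mul1r ler_pdivrMr ?exprn_gt0//.
(* The linear terms cancel, leaving [u ^ 2] times a cofactor that stays positive up to [u = 1/2]
   because [3/8 - 11/32 > 0]. *)
have -> : (1 + u + u ^+ 2) * (1 - u / 4) ^+ 4 =
  1 + u ^+ 2 * (3/8 - (11/16) * u + (81/256) * u ^+ 2 - (15/256) * u ^+ 3 + u ^+ 4/256) by field.
rewrite lerDl mulr_ge0 ?sqr_ge0//.
have := sqr_ge0 u; have := sqr_ge0 (u^+2).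
have -> : u ^+ 3 = u * u ^+2 by ring.
have -> : u ^+ 4 = (u ^+ 2) ^+2 by ring.
nra.
Qed.

(** The linear term of the quadratic bound averages to zero because [y] is centred under [p], which
    leaves [1 + l ^ 2 * c ^ 2]. *)
Lemma mgf_le (R : realType) (J : finType) (p y : J -> R) (c l : R) :
  (forall j, 0 <= p j) -> \sum_j p j = 1 -> \sum_j p j * y j = 0 ->
  (forall j, `|y j| <= c) -> `|l| * c <= 1/2 ->
  \sum_j p j * expR (l * y j) <= expR (l ^+ 2 * c ^+ 2).
Proof.
move=> p0 p1 py0 yc lc.
apply: (@le_trans _ _ (\sum_j p j * (1 + l * y j + l ^+ 2 * c ^+ 2))).
  apply: ler_sum => j _; apply: ler_wpM2l => //.
  apply: (le_trans (expR_le_quad _)).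
    by rewrite normrM; apply: le_trans lc; apply: ler_wpM2l.
  rewrite lerD2l exprMn ler_wpM2l ?sqr_ge0// -[leLHS]real_normK ?num_real//.
  by rewrite lerXn2r// nnegrE ?(le_trans _ (yc j)).
rewrite (eq_bigr (fun j => p j * (1 + l ^+ 2 * c ^+ 2) + l * (p j * y j))); last first.
  by move=> j _; ring.
rewrite big_split/= -mulr_suml p1 -mulr_sumr py0 mulr0 addr0 mul1r.
exact: expR_ge1Dx.
Qed.

(** The functions equal to [j0] off [S] encode the maps from [S] to [J], so the left side is a tail
    probability under the product law [p ^ S]. Markov's inequality for the exponential, followed by
    factorization over [S], reduces it to [mgf_le]. *)
Lemma finite_chernoff (R : realType) (I J : finType) (S : {set I}) (j0 : J)
    (p y : J -> R) (c s : R) :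
  (forall j, 0 <= p j) -> \sum_j p j = 1 -> \sum_j p j * y j = 0 ->
  (forall j, `|y j| <= c) -> 0 < s -> 0 < c ->
  \sum_(v in pffun_on j0 (mem S) predT | s *+ #|S| < \sum_(i in S) y (v i))
     \prod_(i in S) p (v i)
  <= expR (- (#|S|%:R * (s ^+ 2 / (4 * c ^+ 2)))).
Proof.
move=> p0 p1 py0 yc s0 c0.
(* For [c < s] the event is empty, and [l * c <= 1/2] would fail. *)
case: (lerP s c) => [sc|cs]; last first.
  rewrite big_pred0 ?expR_ge0// => v; apply/negbTE; rewrite negb_and -leNgt.
  apply/orP; right; rewrite -sumr_const; apply: ler_sum => i _.
  by apply: le_trans (ltW cs); apply: le_trans (yc _); exact: ler_norm.
(* The minimizer of [l ^ 2 * c ^ 2 - l * s], with minimum [- s ^ 2 / (4 * c ^ 2)]; [s <= c] gives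
   [l * c <= 1/2]. *)
pose l := s / (2 * c ^+ 2).
have l0 : 0 <= l by rewrite /l; apply: divr_ge0; [exact: ltW|rewrite mulr_ge0 ?sqr_ge0].
apply: (@le_trans _ _ (\sum_(v in pffun_on j0 (mem S) predT)
    \prod_(i in S) (p (v i) * expR (l * (y (v i) - s))))).
  rewrite big_mkcondr/=; apply: ler_sum => v _; case: ifPn => [h|_].
    rewrite big_split/= ler_peMr ?prodr_ge0// -expR_sum -mulr_sumr.
    rewrite -[leLHS]expR0 ler_expR mulr_ge0//.
    by rewrite sumrB sumr_const subr_ge0 ltW.
  by apply: prodr_ge0 => i _; rewrite mulr_ge0 ?expR_ge0.
(* The sum over all maps of a product is a product of sums: this is where independence acts. *)
rewrite -(big_distr_big j0 (mem S) predT (fun i j => p j * expR (l * (y j - s))))/=.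
rewrite prodr_const -mulrN expRM_natl lerXn2r// ?nnegrE ?expR_ge0//.
  by apply: sumr_ge0 => j _; rewrite mulr_ge0 ?expR_ge0.
rewrite (eq_bigr (fun j => p j * expR (l * y j) * expR (- (l * s)))); last first.
  by move=> j _; rewrite mulrBr expRD mulrA.
rewrite -mulr_suml.
apply: (@le_trans _ _ (expR (l ^+ 2 * c ^+ 2) * expR (- (l * s)))).
  apply: ler_wpM2r; first exact: expR_ge0.
  apply: mgf_le => //; rewrite ger0_norm// /l.
  have -> : s / (2 * c ^+ 2) * c = s / c / 2 by field; rewrite gt_eqF.
  by rewrite ler_pM2r// ler_pdivrMr// mul1r.
rewrite -expRD ler_expR le_eqVlt; apply/orP; left; apply/eqP.
by rewrite /l; field; rewrite gt_eqF.
Qed.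

Lemma probability_bigsetU_le d (T : measurableType d) (R : realType)
    (P : probability T R) (I : Type) (r : seq I) (Q : pred I)
    (F : I -> set T) :
  (forall i, Q i -> measurable (F i)) ->
  (P (\big[setU/set0]_(i <- r | Q i) F i) <= \sum_(i <- r | Q i) P (F i))%E.
Proof.
move=> mF; elim: r => [|i r ih]; first by rewrite !big_nil measure0.
rewrite !big_cons; case: ifPn => // Qi.
have mr : measurable (\big[setU/set0]_(j <- r | Q j) F j).
  exact: bigsetU_measurable.
apply: (@le_trans _ _ (P (F i) + P (\big[setU/set0]_(j <- r | Q j) F j))%E).
  by apply: measureU2 => //; exact: mF.
exact: leeD2l.
Qed.

(** * Concentration for finitely valued variables that are independent given an event *)

Section concentration.
Context d (W : measurableType d) (R : realType) (P : probability W R).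
Context (I J : finType) (D : I -> W -> J) (E : set W) (S : {set I}) (p : J -> R).
Hypothesis mE : measurable E.
Hypothesis mD : forall i j, measurable [set w | D i w = j].
Hypothesis indepD : forall v : I -> J,
  P (E `&` \bigcap_(i in [set` S]) [set w | D i w = v i])
  = (P E * \prod_(i in S) (p (v i))%:E)%E.
Hypothesis p0 : forall j, 0 <= p j.
Hypothesis p1 : \sum_j p j = 1.

(** The event [E] serves either as the whole space or as the event that the hit set is [S]. The
    factor [P E] is kept in the bound so that summing over disjoint conditioning events costs
    nothing. *)
Lemma one_sided_concentration (y : J -> R) (c s : R) :
  \sum_j p j * y j = 0 -> (forall j, `|y j| <= c) -> 0 < s -> 0 < c ->
  exists F, [/\ measurable F,
    (P F <= P E * (expR (- (#|S|%:R * (s ^+ 2 / (4 * c ^+ 2)))))%:E)%E &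
    forall w, E w -> ~ F w -> \sum_(i in S) y (D i w) <= s *+ #|S|].
Proof.
move=> py0 yc s0 c0.
have [j0 _] : exists j0 : J, true.
  have [j _|J0] := pickP (@predT J); first by exists j.
  by move: p1; rewrite big_pred0// => /eqP; rewrite eq_sym oner_eq0.
pose bad (v : {ffun I -> J}) :=
  (v \in pffun_on j0 (mem S) predT) && (s *+ #|S| < \sum_(i in S) y (v i)).
pose G (v : {ffun I -> J}) := E `&` \bigcap_(i in [set` S]) [set w | D i w = v i].
have mG v : measurable (G v).
  by apply: measurableI => //; apply: fin_bigcap_measurable.
(* The exceptional event is the union over the value patterns on [S] with a large sum; each pattern
   has probability [P E] times a product of values of [p]. *)
exists (\big[setU/set0]_(v | bad v) G v); split.
- exact: bigsetU_measurable.
- apply: le_trans (probability_bigsetU_le _ _ _) _ => //.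
  rewrite (eq_bigr (fun v : {ffun I -> J} => (P E * (\prod_(i in S) p (v i))%:E)%E)); last first.
    by move=> v _; rewrite /G (indepD v) prodEFin.
  rewrite -ge0_sume_distrr; last first.
    by move=> v _; rewrite lee_fin prodr_ge0.
  apply: lee_pmul => //; first by apply: sume_ge0 => v _; rewrite lee_fin prodr_ge0.
  by rewrite sumEFin lee_fin; exact: finite_chernoff.
- move=> w Ew nF; rewrite leNgt; apply/negP => h; apply: nF.
  pose v := [ffun i => if i \in S then D i w else j0].
  rewrite -bigcup_pred; exists v => /=; last first.
    by split => // i /= iS; rewrite /v ffunE iS.
  apply/andP; split.
    apply/pffun_onP; split => //; apply/supportP => i.
    by rewrite ffunE => /negbTE ->.
  rewrite (lt_le_trans h)// le_eqVlt; apply/orP; left; apply/eqP.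
  by apply: eq_bigr => i iS; rewrite ffunE iS.
Qed.

Lemma two_sided_concentration (y : J -> R) (c s : R) :
  \sum_j p j * y j = 0 -> (forall j, `|y j| <= c) -> 0 < s -> 0 < c ->
  exists F, [/\ measurable F,
    (P F <= P E * (2 * expR (- (#|S|%:R * (s ^+ 2 / (4 * c ^+ 2)))))%:E)%E &
    forall w, E w -> ~ F w -> `|\sum_(i in S) y (D i w)| <= s *+ #|S|].
Proof.
move=> py0 yc s0 c0.
have [F [mF PF hF]] := one_sided_concentration py0 yc s0 c0.
have [|j|G [mG PG hG]] := @one_sided_concentration (fun j => - y j) c s _ _ s0 c0.
- under eq_bigr do rewrite mulrN.
  by rewrite sumrN py0 oppr0.
- by rewrite normrN.
exists (F `|` G); split; first exact: measurableU.
  apply: (@le_trans _ _ (P F + P G)%E); first exact: measureU2.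
  apply: (le_trans (leeD PF PG)).
  by rewrite [2 * _]mulr_natl mulr2n EFinD ge0_muleDr ?lee_fin ?expR_ge0.
move=> w Ew /not_orP[nF nG]; rewrite ler_norml hF// andbT lerNl -sumrN.
exact: hG.
Qed.

End concentration.

(** * Finite partitions, total variation and rounding *)

Lemma probability_preim_fin d (T : measurableType d) (R : realType)
    (P : probability T R) (J : finType) (D : T -> J) (B : set T) (Q : {pred J}) :
  (forall j, measurable [set x | D x = j]) -> measurable B ->
  P ([set x | D x \in Q] `&` B) = (\sum_(j in Q) P ([set x | D x = j] `&` B))%E.
Proof.
move=> mD mB; rewrite -big_enum/=.
have -> : [set x | D x \in Q] = [set x | D x \in enum Q].
  by apply/seteqP; split => x /=; rewrite mem_enum.
have mseq (s : seq J) : measurable [set x | D x \in s].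
  elim: s => [|j s ih].
    rewrite (_ : [set x | _] = set0); first exact: measurable0.
    by apply/seteqP; split.
  rewrite (_ : [set x | _] = [set x | D x = j] `|` [set x | D x \in s]).
    exact: measurableU.
  apply/seteqP; split => x /=; rewrite inE.
    by case/orP => [/eqP|]; [left|right].
  by case=> [->|->]; rewrite ?eqxx ?orbT.
elim: (enum Q) (enum_uniq Q) => [_|j s ih /= /andP[js us]].
  rewrite big_nil (_ : _ `&` _ = set0) ?measure0//.
  by apply/seteqP; split => x //= [].
rewrite big_cons -ih//.
rewrite (_ : [set x | _] `&` B =
  ([set x | D x = j] `&` B) `|` ([set x | D x \in s] `&` B)); last first.
  rewrite -setIUl; congr (_ `&` _); apply/seteqP; split => x /=; rewrite inE.
    by case/orP => [/eqP|]; [left|right].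
  by case=> [->|->]; rewrite ?eqxx ?orbT.
apply: measureU; [exact: measurableI|exact: measurableI|].
apply/seteqP; split => x //= [[-> _] [js' _]].
by rewrite js' in js.
Qed.

Lemma fine_probability_preim_fin d (T : measurableType d) (R : realType)
    (P : probability T R) (J : finType) (D : T -> J) (B : set T) (Q : {pred J}) :
  (forall j, measurable [set x | D x = j]) -> measurable B ->
  fine (P ([set x | D x \in Q] `&` B)) =
  \sum_(j in Q) fine (P ([set x | D x = j] `&` B)).
Proof.
move=> mD mB; rewrite probability_preim_fin// sum_fine// => j _.
by apply: fin_num_measure; exact: measurableI.
Qed.

(** Values in [[0, 1]] keep the set of differences bounded, so that [sup] is a genuine supremum and
    not a default value. *)
Lemma le_tv_dist d (T : measurableType d) (R : realType) (alpha beta : set T -> R) A :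
  (forall A, measurable A -> 0 <= alpha A <= 1) ->
  (forall A, measurable A -> 0 <= beta A <= 1) ->
  measurable A -> `|alpha A - beta A| <= tv_dist alpha beta.
Proof.
move=> ha hb mA; apply: ub_le_sup; last by exists A.
exists 1 => _ [C mC <-]; have := ha _ mC; have := hb _ mC.
by move=> /andP[? ?] /andP[? ?]; rewrite ler_norml; apply/andP; split; lra.
Qed.

(** Both laws have mass one, so [c] may be shifted by [a]; hence the factor is the oscillation
    [b - a] and not a bound on [c] itself. *)
Lemma expectation_diff_le (R : realType) (J : finType) (p q c : J -> R) (a b K : R) :
  \sum_j p j = 1 -> \sum_j q j = 1 -> (forall j, a <= c j <= b) -> a <= b ->
  (forall Q : {pred J}, `|\sum_(j in Q) p j - \sum_(j in Q) q j| <= K) ->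
  \sum_j c j * p j - \sum_j c j * q j <= (b - a) * K.
Proof.
move=> p1 q1 hc ab hK.
have -> : \sum_j c j * p j - \sum_j c j * q j = \sum_j (c j - a) * (p j - q j).
  rewrite [RHS](eq_bigr (fun j => (c j * p j - c j * q j) + (- a) * (p j - q j))).
    by rewrite big_split/= sumrB -mulr_sumr sumrB p1 q1 subrr mulr0 addr0.
  by move=> j _; ring.
(* The event of the positive part of the signed measure [p - q]. *)
pose Q := [pred j | 0 <= p j - q j].
apply: (@le_trans _ _ (\sum_(j in Q) (b - a) * (p j - q j))).
  rewrite [leRHS]big_mkcond; apply: ler_sum => j _; rewrite inE.
  have /andP[h1 h2] := hc j.
  case: ifPn => [h|]; first by rewrite ler_wpM2r// lerB.
  by rewrite -ltNge => h; rewrite mulr_ge0_le0 ?subr_ge0// ltW.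
rewrite -mulr_sumr sumrB ler_wpM2l ?subr_ge0//.
exact: le_trans (ler_norm _) (hK Q).
Qed.

Lemma discretization d (T : measurableType d) (R : realType) (B : set T)
    (phi : T -> R) (a b eta : R) :
  measurable B -> measurable_fun B phi -> a <= b -> 0 < eta ->
  (forall x, B x -> a <= phi x <= b) ->
  exists K (D : T -> 'I_K.+1) (c : 'I_K.+1 -> R),
    [/\ forall j, measurable [set x | D x = j], forall j, a <= c j <= b &
        forall x, B x -> c (D x) <= phi x <= c (D x) + eta].
Proof.
move=> mB mphi ab eta0 hphi.
pose K := Num.truncn ((b - a) / eta).
(* Extension of [phi] by zero off [B] makes [g] measurable on the whole space. *)
pose g x := ((phi \_ B) x - a) / eta.
have mg : measurable_fun setT g.
  apply: measurable_funM => //; apply: measurable_funB => //.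
  exact: (measurable_restrictT phi mB).1 mphi.
have mlt n : measurable [set x | (Num.truncn (g x) <= n)%N].
  rewrite (_ : [set x | _] = setT `&` g @^-1` `]-oo, n.+1%:R[); first exact: mg.
  by apply/seteqP; split => x /=; rewrite in_itv/= truncn_le_nat// => -[].
have meq n : measurable [set x | Num.truncn (g x) = n].
  case: n => [|n].
    rewrite (_ : [set x | _] = [set x | (Num.truncn (g x) <= 0)%N])//.
    by apply/seteqP; split => x /=; [move=> ->|rewrite leqn0 => /eqP].
  rewrite (_ : [set x | _] =
    [set x | (Num.truncn (g x) <= n.+1)%N] `\` [set x | (Num.truncn (g x) <= n)%N]).
    exact: measurableD.
  apply/seteqP; split => x /=.
    by move=> ->; split => //; rewrite ltnn.
  by case=> h1 /negP; rewrite -ltnNge => h2; apply/eqP; rewrite eqn_leq h1.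
have K0 : 0 <= (b - a) / eta by rewrite divr_ge0 ?subr_ge0// ltW.
(* Rounding down to the grid [a + j * eta]. On [B] the index is at most [K]; the default value of
   [inord] can only occur off [B], where nothing is claimed. *)
exists K, (fun x => inord (Num.truncn (g x))), (fun j => a + j%:R * eta).
split=> [j|j|x Bx].
- rewrite (_ : [set x | _] =
    \bigcup_(n in [set n | inord n = j]) [set x | Num.truncn (g x) = n]).
    by apply: bigcup_measurable => n _; exact: meq.
  apply/seteqP; split => x /=; first by move=> h; exists (Num.truncn (g x)).
  by case=> n /= hn ->.
- apply/andP; split; first by rewrite lerDl mulr_ge0// ltW.
  rewrite -lerBrDl -ler_pdivlMr//.
  by rewrite -truncn_ge_nat// -ltnS ltn_ord.
- have /andP[h1 h2] := hphi _ Bx.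
  have gE : g x = (phi x - a) / eta by rewrite /g patchE mem_set.
  have g0 : 0 <= g x by rewrite gE divr_ge0 ?subr_ge0// ltW.
  rewrite inordK; last first.
    by rewrite ltnS le_truncn// gE ler_pM2r ?invr_gt0// lerB.
  have /andP[i1 i2] := truncn_itv g0.
  rewrite {2}gE ler_pdivlMr// in i1.
  rewrite {1}gE ltr_pdivrMr// -natr1 mulrDl mul1r in i2.
  by apply/andP; split; lra.
Qed.

(** * The random hit set and the concentration of its relative size *)

Section hits_concentration.
Context dW dT (W : measurableType dW) (T : measurableType dT) (R : realType)
  (P : probability W R) (N : nat).
Variables (B : set T) (x : 'I_N -> {RV P >-> T}).
Hypothesis mB : measurable B.

Lemma measurable_hit (b : bool) i : measurable [set w | (x i w \in B) = b].
Proof.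
have -> : [set w | (x i w \in B) = b] = x i @^-1` (if b then B else ~` B).
  apply/seteqP; split => w /=; case: b.
  - by move/set_mem.
  - by move=> h /mem_set; rewrite h.
  - by move/mem_set.
  - by move=> h; apply/negP => /set_mem.
rewrite -[X in measurable X]setTI; apply: measurable_funPT => //.
by case: b => //; exact: measurableC.
Qed.

Lemma measurable_hits S : measurable [set w | hits B x w = S].
Proof.
have -> : [set w | hits B x w = S] =
    \bigcap_(i in [set: 'I_N]) [set w | (x i w \in B) = (i \in S)].
  apply/seteqP; split => w /=; first by move=> <- i _ /=; rewrite inE.
  by move=> h; apply/setP => i; rewrite inE; exact: h.
by apply: fin_bigcap_measurable => // i _; exact: measurable_hit.
Qed.

Lemma hit_frequency_concentration (mu : probability T R) (s : R) :
  (0 < N)%N -> iid_sample x mu -> 0 < s ->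
  exists F, [/\ measurable F,
    (P F <= (2 * expR (- (N%:R * (s ^+ 2 / 4))))%:E)%E &
    forall w, ~ F w ->
      `|#|~: hits B x w|%:R / N%:R - fine (mu (~` B))| <= s].
Proof.
move=> N0 iidx s0.
set r := fine (mu (~` B)).
have muB : mu B = (1 - r)%:E.
  have fB : mu B \is a fin_num by exact: fin_num_measure.
  by rewrite /r probability_setC// -(fineK fB) -EFinB/= subKr.
have r01 : 0 <= r <= 1.
  rewrite /r fine_ge0//= -lee_fin fineK ?fin_num_measure//; last exact: measurableC.
  by apply: probability_le1; exact: measurableC.
(* [true] stands for a hit of [B]. The score [y] is the centred indicator of a miss, bounded by
   1. *)
pose p (b : bool) := if b then 1 - r else r.
pose y (b : bool) := if b then - r else 1 - r.
have [|||||||F [mF PF hF]] := @two_sided_concentration _ W R P _ bool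
    (fun i w => x i w \in B) setT [set: 'I_N]%SET p _ _ _ _ _ y 1 s _ _ s0 ltr01.
- exact: measurableT.
- by move=> i b; exact: measurable_hit.
- move=> v; rewrite setTI probability_setT mul1e.
  transitivity (P (\bigcap_(i in [set: 'I_N]) (x i @^-1` (if v i then B else ~` B)))).
    have -> : [set` [set: 'I_N]%SET] = [set: 'I_N].
      by apply/seteqP; split => i //= _; rewrite inE.
    congr (P _); apply: eq_bigcapr => i _; apply/seteqP; split => w /=; case: (v i).
    - by move/set_mem.
    - by move=> h /mem_set; rewrite h.
    - by move/mem_set.
    - by move=> h; apply/negP => /set_mem.
  rewrite iidx; last by move=> i; case: ifP => // _; exact: measurableC.
  rewrite (eq_bigl (fun i => i \in [set: 'I_N]%SET)); last by move=> i; rewrite inE.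
  apply: eq_bigr => i _; rewrite /p; case: (v i) => //.
  by rewrite /r fineK// fin_num_measure//; exact: measurableC.
- by case; rewrite /p; lra.
- by rewrite big_bool/= /p; ring.
- by rewrite big_bool/= /p /y; ring.
- by case; rewrite /y ler_norml; apply/andP; split; lra.
exists F; split => //.
  apply: (le_trans PF); rewrite probability_setT mul1e cardsT card_ord.
  by rewrite expr1n mulr1.
move=> w /(hF _ I).
have N0' : 0 < N%:R :> R by rewrite ltr0n.
have -> : \sum_(i in [set: 'I_N]%SET) y (x i w \in B) =
    (#|~: hits B x w|%:R / N%:R - r) * N%:R.
  rewrite mulrBl divfK ?gt_eqF//.
  rewrite (eq_bigr (fun i => (if i \in ~: hits B x w then 1 else 0) - r)); last first.
    by move=> i _; rewrite !inE /y; case: ifP => _; rewrite ?sub0r.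
  rewrite big_split/= -big_mkcondr/= !sumr_const cardsT card_ord.
  rewrite mulNrn mulr_natr; congr (_%:R - _).
  by apply: eq_card => i; rewrite unfold_in/= finset.in_setT.
by rewrite normrM (ger0_norm (ltW N0')) cardsT card_ord -[s *+ N]mulr_natr ler_pM2r.
Qed.

End hits_concentration.

(** * Conditional means and averages over the hits *)

Section cond_mean.
Context dV dT (V : measurableType dV) (T : measurableType dT) (R : realType)
  (P : probability V R) (X : {RV P >-> T}).

Lemma cond_law_itv (A B : set T) : measurable A -> measurable B ->
  0 <= cond_law X B A <= 1.
Proof.
move=> mA mB; rewrite /cond_law divr_ge0 ?fine_ge0//=.
have fAB : distribution P X (A `&` B) \is a fin_num.
  by apply: fin_num_measure; exact: measurableI.
have fB : distribution P X B \is a fin_num by exact: fin_num_measure.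
have : fine (distribution P X (A `&` B)) <= fine (distribution P X B).
  rewrite -lee_fin !fineK//; apply: le_measure; rewrite ?inE//.
  exact: measurableI.
have : 0 <= fine (distribution P X B) by rewrite fine_ge0.
rewrite le_eqVlt => /orP[/eqP <- _|h1 h2]; first by rewrite invr0 mulr0.
by rewrite ler_pdivrMr// mul1r.
Qed.

Lemma cond_law_preim_fin (J : finType) (D : T -> J) (B : set T) (Q : {pred J}) :
  (forall j, measurable [set x | D x = j]) -> measurable B ->
  cond_law X B [set x | D x \in Q] =
  \sum_(j in Q) cond_law X B [set x | D x = j].
Proof.
move=> mD mB; rewrite /cond_law -mulr_suml; congr (_ / _).
exact: (fine_probability_preim_fin (distribution P X)).
Qed.

Lemma cond_lawT (B : set T) : (0 < distribution P X B)%E -> measurable B ->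
  cond_law X B setT = 1.
Proof.
move=> B0 mB; rewrite /cond_law setTI divff// gt_eqF// fine_gt0// B0/=.
by rewrite ltey_eq fin_num_measure.
Qed.

Lemma integral_const_bounds (G : set V) (h : V -> R) (c c' : R) :
  measurable G -> measurable_fun G h -> 0 <= c ->
  (forall v, G v -> c <= h v <= c') ->
  (c%:E * P G <= \int[P]_(v in G) (h v)%:E <= c'%:E * P G)%E.
Proof.
move=> mG mh c0 hc.
have mh' : measurable_fun G (EFin \o h) by exact/measurable_EFinP.
rewrite -!integral_cst//; apply/andP; split; apply: ge0_le_integral => //.
- by move=> v Gv; rewrite lee_fin; have /andP[] := hc _ Gv.
- by move=> v Gv; rewrite lee_fin; have /andP[? _] := hc _ Gv; exact: le_trans c0 _.
- by move=> v Gv; rewrite lee_fin; have /andP[] := hc _ Gv.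
Qed.

(** The number [m] is the mean of [phi X] given [X] in [B]. Its comparison with finite sums, for
    every rounding of [phi], makes total variation bounds on finite partitions applicable to it. *)
Lemma cond_mean_discretized (B : set T) (phi : T -> R) (a b : R) :
  measurable B -> (0 < distribution P X B)%E -> measurable_fun B phi -> 0 <= a ->
  (forall x, B x -> a <= phi x <= b) ->
  exists m, [/\ a <= m <= b,
    (\int[P]_(v in X @^-1` B) (phi (X v))%:E)%E =
      (m * fine (distribution P X B))%:E &
    forall eta K (D : T -> 'I_K.+1) (c : 'I_K.+1 -> R),
      (forall j, measurable [set x | D x = j]) -> (forall j, 0 <= c j) ->
      (forall x, B x -> c (D x) <= phi x <= c (D x) + eta) ->
      `|m - \sum_j c j * cond_law X B [set x | D x = j]| <= eta].
Proof.
move=> mB B0 mphi a0 hphi.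
have mX : measurable_fun setT X by [].
have mpre (A : set T) : measurable A -> measurable (X @^-1` A).
  by move=> mA; rewrite -[X in measurable X]setTI; exact: mX.
have mphiX (G : set V) : G `<=` X @^-1` B -> measurable G ->
    measurable_fun G (fun v => phi (X v)).
  move=> GB mG; apply: (@measurable_comp _ _ _ _ _ _ B) => //.
    by move=> _ [v /GB Bv <-].
  by apply: measurable_funS mX.
have fB : distribution P X B \is a fin_num by exact: fin_num_measure.
have pB : 0 < fine (distribution P X B) by rewrite fine_gt0// B0/= ltey_eq fB.
set I := (\int[P]_(v in X @^-1` B) _)%E.
have /andP[I1 I2] : (a%:E * distribution P X B <= I <= b%:E * distribution P X B)%E.
  apply: integral_const_bounds => //; first exact: mpre.
    by apply: mphiX => //; exact: mpre.
  by move=> v; exact: hphi.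
have fI : I \is a fin_num.
  rewrite ge0_fin_numE; last by apply: le_trans I1; rewrite mule_ge0.
  by apply: (le_lt_trans I2); rewrite -(fineK fB) -EFinM ltry.
exists (fine I / fine (distribution P X B)); split.
- rewrite ler_pdivrMr// ler_pdivlMr//.
  by rewrite -!lee_fin !EFinM !fineK// I1 I2.
- by rewrite divfK ?gt_eqF// fineK.
move=> eta K D c mD c0 hc.
pose q j := fine (distribution P X ([set x | D x = j] `&` B)).
(* The integral is cut along the cells of [D], on each of which [phi] lies between [c j] and
   [c j + eta]. *)
have IE : I = (\sum_j \int[P]_(v in X @^-1` ([set x | D x = j] `&` B)) (phi (X v))%:E)%E.
  have UB : X @^-1` B = \big[setU/set0]_(j <- enum 'I_K.+1) X @^-1` ([set x | D x = j] `&` B).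
    rewrite -bigcup_seq; apply/seteqP; split => v /=.
      by move=> Bv; exists (D (X v)) => //=; rewrite mem_enum.
    by case=> j _ /= [].
  rewrite /I {1}UB ge0_integral_bigsetU//=; first by rewrite big_enum.
  - by move=> j; apply: mpre; exact: measurableI.
  - exact: enum_uniq.
  - by move=> i j _ _ [v [[/= <- _] [/= <- _]]].
  - rewrite -UB; apply/measurable_EFinP; apply: mphiX => //; exact: mpre.
  - rewrite -UB => v Bv; rewrite lee_fin; have /andP[? _] := hphi _ Bv.
    exact: le_trans a0 _.
have hj j : ((c j * q j)%:E <=
    \int[P]_(v in X @^-1` ([set x | D x = j] `&` B)) (phi (X v))%:E <=
    ((c j + eta) * q j)%:E)%E.
  have mjB : measurable ([set x | D x = j] `&` B) by exact: measurableI.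
  rewrite !EFinM fineK; last by exact: fin_num_measure.
  apply: integral_const_bounds => //; first exact: mpre.
    by apply: mphiX => [v /= []|]//; exact: mpre.
  by move=> v /= [<- Bv]; exact: hc.
have qE : \sum_j q j = fine (distribution P X B).
  rewrite /q -(fine_probability_preim_fin (distribution P X) predT mD mB).
  by congr (fine (_ _)); apply/seteqP; split => x //= [].
have l1 : \sum_j c j * q j <= fine I.
  rewrite -lee_fin fineK// IE -sumEFin; apply: lee_sum => j _.
  by have /andP[] := hj j.
have l2 : fine I <= \sum_j c j * q j + eta * fine (distribution P X B).
  rewrite -lee_fin fineK// IE -qE mulr_sumr -big_split/= -sumEFin.
  by apply: lee_sum => j _; rewrite -mulrDl; have /andP[] := hj j.
have -> : \sum_j c j * cond_law X B [set x | D x = j] =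
    (\sum_j c j * q j) / fine (distribution P X B).
  by rewrite mulr_suml; apply: eq_bigr => j _; rewrite -mulrA.
rewrite -mulrBl normrM [X in _ * X]gtr0_norm ?invr_gt0// ler_pdivrMr//.
by rewrite ler_norml; apply/andP; split; nra.
Qed.

End cond_mean.

(** The sample size is random, so Chernoff's bound is applied given each possible hit set of size at
    least [k]. In the error, [s] is the fluctuation, the last term the bias, and [eta] enters twice:
    for rounding [phi] at the samples and in the mean [m]. *)
Lemma hit_average_concentration dV dW dT (V : measurableType dV)
    (W : measurableType dW) (T : measurableType dT) (R : realType)
    (Pf : probability V R) (X : {RV Pf >-> T}) (P : probability W R) (N : nat)
    (B : set T) (x : 'I_N -> {RV P >-> T}) (nu : probability T R)
    (phi : T -> R) (a b s eta k m : R) :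
  measurable B -> (0 < distribution Pf X B)%E -> iid_hits B x nu ->
  measurable_fun B phi -> 0 <= a -> a < b ->
  (forall y, B y -> a <= phi y <= b) -> 0 < s -> 0 < eta -> 0 < k ->
  (forall K (D : T -> 'I_K.+1) (c : 'I_K.+1 -> R),
      (forall j, measurable [set y | D y = j]) -> (forall j, 0 <= c j) ->
      (forall y, B y -> c (D y) <= phi y <= c (D y) + eta) ->
      `|m - \sum_j c j * cond_law X B [set y | D y = j]| <= eta) ->
  exists F, [/\ measurable F,
    (P F <= (2 * expR (- (k * (s ^+ 2 / (4 * (b - a) ^+ 2)))))%:E)%E &
    forall w, ~ F w -> k <= #|hits B x w|%:R ->
      `|#|hits B x w|%:R^-1 * \sum_(i in hits B x w) phi (x i w) - m|
      <= s + 2 * eta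
         + (b - a) * tv_dist (fun A => fine (nu A)) (cond_law X B)].
Proof.
move=> mB B0 iidx mphi a0 ab hphi s0 eta0 k0 hm.
have [K [D [c [mD hc hD]]]] := discretization mB mphi (ltW ab) eta0 hphi.
have {hm} hm : `|m - \sum_j c j * cond_law X B [set y | D y = j]| <= eta.
  by apply: hm => // j; have /andP[+ _] := hc j; exact: le_trans.
pose p j := fine (nu [set y | D y = j]).
have p0 j : 0 <= p j by rewrite fine_ge0.
have pQ (Q : {pred 'I_K.+1}) : fine (nu [set y | D y \in Q]) = \sum_(j in Q) p j.
  rewrite -[[set y | D y \in Q]]setIT fine_probability_preim_fin//.
  by apply: eq_bigr => j _; rewrite setIT.
have preimT : [set y | D y \in predT] = setT by apply/seteqP; split.
have p1 : \sum_j p j = 1.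
  by rewrite -(pQ predT) preimT probability_setT.
have q1 : \sum_j cond_law X B [set y | D y = j] = 1.
  by rewrite -(cond_law_preim_fin X predT mD mB) preimT cond_lawT.
pose mu := \sum_j c j * p j.
have hTV (Q : {pred 'I_K.+1}) :
    `|\sum_(j in Q) p j - \sum_(j in Q) cond_law X B [set y | D y = j]|
    <= tv_dist (fun A => fine (nu A)) (cond_law X B).
  rewrite -(cond_law_preim_fin X Q mD mB) -pQ.
  have mQ : measurable [set y | D y \in Q].
    rewrite (_ : [set y | _] = \bigcup_(j in [set` Q]) [set y | D y = j]).
      by apply: fin_bigcup_measurable.
    apply/seteqP; split => y /=; first by move=> h; exists (D y).
    by case=> j /= jQ ->.
  apply: (le_tv_dist (alpha := fun A => fine (nu A))) => //.
    move=> A mA; rewrite fine_ge0//= -lee_fin fineK ?fin_num_measure//.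
    exact: probability_le1.
  by move=> A mA; exact: cond_law_itv.
have hmu : `|mu - \sum_j c j * cond_law X B [set y | D y = j]|
    <= (b - a) * tv_dist (fun A => fine (nu A)) (cond_law X B).
  rewrite ler_norml lerNl opprB; apply/andP; split.
    apply: (expectation_diff_le q1 p1 hc (ltW ab)) => Q.
    by rewrite distrC.
  exact: (expectation_diff_le p1 q1 hc (ltW ab)).
have mua : a <= mu <= b.
  apply/andP; split.
    rewrite -[leLHS]mulr1 -p1 mulr_sumr; apply: ler_sum => j _.
    by rewrite ler_wpM2r//; have /andP[] := hc j.
  rewrite -[leRHS]mulr1 -p1 mulr_sumr; apply: ler_sum => j _.
  by rewrite ler_wpM2r//; have /andP[] := hc j.
pose y j := c j - mu.
have ybd j : `|y j| <= b - a.
  have /andP[] := hc j; move: mua => /andP[? ?] ? ?.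
  by rewrite /y ler_norml; apply/andP; split; lra.
have py0 : \sum_j p j * y j = 0.
  under eq_bigr do rewrite mulrBr mulrC.
  by rewrite sumrB -mulr_suml p1 mul1r subrr.
have ba0 : 0 < b - a by rewrite subr_gt0.
have mDx i j : measurable [set w | D (x i w) = j].
  rewrite (_ : [set w | _] = x i @^-1` [set y | D y = j])//.
  rewrite -[X in measurable X]setTI; exact: measurable_funPT.
(* Given the hit set [S], the rounded samples are independent with law [p], and [y] is centred under
   [p]. *)
have hF (S : {set 'I_N}) : exists F, [/\ measurable F,
    (P F <= P [set w | hits B x w = S] *
      (2 * expR (- (#|S|%:R * (s ^+ 2 / (4 * (b - a) ^+ 2)))))%:E)%E &
    forall w, hits B x w = S -> ~ F w ->
      `|\sum_(i in S) y (D (x i w))| <= s *+ #|S|].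
  apply: (@two_sided_concentration _ W R P _ _ (fun i w => D (x i w))
    [set w | hits B x w = S] S p) => //.
    exact: measurable_hits.
  move=> v; have := iidx S (fun i => [set y | D y = v i]) (fun i => mD (v i)).
  move=> ->; congr (_ * _)%E; apply: eq_bigr => i _.
  by rewrite fineK// fin_num_measure.
have [F hF'] := choice hF.
pose L (S : {set 'I_N}) := k <= #|S|%:R.
pose e := s ^+ 2 / (4 * (b - a) ^+ 2).
have e0 : 0 <= e by rewrite divr_ge0 ?sqr_ge0// mulr_ge0 ?sqr_ge0.
exists (\big[setU/set0]_(S | L S) F S); split.
- by apply: bigsetU_measurable => S _; have [] := hF' S.
- apply: (le_trans (probability_bigsetU_le _ _ _)).
    by move=> S _; have [] := hF' S.
  apply: (@le_trans _ _ (\sum_(S | L S) P [set w | hits B x w = S] *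
      (2 * expR (- (k * e)))%:E)%E).
    apply: lee_sum => S LS; have [_ + _] := hF' S => /le_trans; apply.
    apply: lee_wpmul2l => //; rewrite lee_fin ler_wpM2l// ler_expR lerN2.
    by rewrite ler_wpM2r.
  (* The events that the hit set is [S] are disjoint with total probability one, so the sum over [S]
     adds no factor. *)
  rewrite -ge0_sume_distrl// -[leRHS]mul1e; apply: lee_wpmul2r.
    by rewrite lee_fin mulr_ge0 ?expR_ge0.
  have := probability_preim_fin P (D := hits B x) predT (measurable_hits x mB)
    (@measurableT _ W).
  under eq_bigr do rewrite setIT.
  rewrite setIT (_ : [set w | _] = setT); last by apply/seteqP; split.
  rewrite probability_setT => ->; rewrite [leRHS](bigID L)/=.
  by rewrite leeDl// sume_ge0.
move=> w; rewrite -bigcup_pred => nF kH.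
set H := hits B x w in kH *.
have H0 : 0 < #|H|%:R :> R by exact: lt_le_trans kH.
have {}nF : ~ F H w by move=> h; apply: nF; exists H.
have [_ _ /(_ w erefl nF) hy] := hF' H.
have hB i : i \in H -> B (x i w) by rewrite inE => /set_mem.
have d1 : `|\sum_(i in H) phi (x i w) - \sum_(i in H) c (D (x i w))| <= eta * #|H|%:R.
  rewrite -sumrB; apply: (le_trans (ler_norm_sum _ _ _)).
  rewrite mulr_natr -sumr_const; apply: ler_sum => i /hB /hD /andP[h1 h2].
  by rewrite ler_norml; apply/andP; split; lra.
have d2 : `|\sum_(i in H) c (D (x i w)) - mu * #|H|%:R| <= s * #|H|%:R.
  by move: hy; rewrite /y sumrB sumr_const -[s *+ _]mulr_natr -[mu *+ _]mulr_natr.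
have d3 : `|\sum_(i in H) phi (x i w) - m * #|H|%:R| <=
    (s + 2 * eta + (b - a) * tv_dist (fun A => fine (nu A)) (cond_law X B))
    * #|H|%:R.
  move: d1 d2 hmu hm; rewrite !ler_norml.
  set A1 := \sum_(i in H) _; set A2 := \sum_(i in H) _; set A3 := \sum_j _.
  set t := (b - a) * _; set n := #|H|%:R in H0 *.
  move=> /andP[a1 a2] /andP[b1 b2] /andP[c1 c2] /andP[e1 e2].
  have : m * n <= (mu + t + eta) * n by rewrite ler_pM2r//; lra.
  have : (mu - t - eta) * n <= m * n by rewrite ler_pM2r//; lra.
  by move=> ? ?; apply/andP; split; lra.
rewrite (_ : _ - m = #|H|%:R^-1 * (\sum_(i in H) phi (x i w) - m * #|H|%:R)); last first.
  by field; rewrite gt_eqF.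
by rewrite normrM gtr0_norm ?invr_gt0// mulrC ler_pdivrMr.
Qed.

(** * Measurability of the output *)

Lemma measurable_fun_hits dW dT (W : measurableType dW) (T : measurableType dT)
    (R : realType) (P : probability W R) (N : nat) (B : set T)
    (x : 'I_N -> {RV P >-> T}) (g : {set 'I_N} -> R) :
  measurable B -> measurable_fun setT (fun w => g (hits B x w)).
Proof.
move=> mB; rewrite (_ : (fun w => _) = (fun w =>
    \sum_S g S * \1_[set w | hits B x w = S] w)); last first.
  apply/funext => w; rewrite (bigD1 (hits B x w))//= big1 ?addr0.
    by rewrite indicE mem_set// mulr1.
  move=> S hS; rewrite indicE memNset ?mulr0//= => e.
  by rewrite e eqxx in hS.
apply: measurable_sum => S; apply: measurable_funM => //.
by apply: measurable_indic; exact: measurable_hits.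
Qed.

Lemma measurable_issa_output dW dT (W : measurableType dW)
    (T : measurableType dT) (R : realType) (P : probability W R)
    (phi : T -> R) (XX : nat -> set T) (N : nat -> nat)
    (x : forall t : nat, 'I_(N t) -> {RV P >-> T}) (n : nat) :
  (forall t, (1 <= t <= n)%N -> measurable (layer XX t)) ->
  (forall t, (1 <= t <= n)%N -> measurable_fun (layer XX t) phi) ->
  measurable_fun setT (issa_output phi XX x n).
Proof.
move=> mL mphi.
have mR t : (t <= n)%N -> measurable_fun setT (Rhat XX x t).
  move=> tn; rewrite /Rhat; case: t tn => [|t] tn //=.
  exact: (@measurable_fun_hits _ _ _ _ _ P _ _ (x t.+1)
    (fun S => #|~: S|%:R / (N t.+1)%:R) (mL t.+1 tn)).
rewrite /issa_output.
under eq_fun do rewrite big_add1 big_mkord.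
apply: measurable_sum => i; have tn : (1 <= i.+1 <= n)%N by rewrite ltn_ord.
apply: measurable_funM; rewrite /Phihat /Phat.
  apply: measurable_funM.
    exact: (@measurable_fun_hits _ _ _ _ _ P _ _ (x i.+1)
      (fun S => #|S|%:R^-1) (mL _ tn)).
  (* The sum over a random index set becomes a sum over all indices once [phi] is replaced by zero
     off the layer. *)
  rewrite (_ : (fun w => _) = (fun w =>
      \sum_j (phi \_ (layer XX i.+1)) (x i.+1 j w))); last first.
    apply/funext => w; rewrite big_mkcond/=; apply: eq_bigr => j _.
    by rewrite patchE inE.
  apply: measurable_sum => j.
  apply: (@measurableT_comp _ _ _ _ _ _ (phi \_ (layer XX i.+1))) => //.
  exact: (measurable_restrictT phi (mL _ tn)).1 (mphi _ tn).
apply: measurable_funM.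
  by apply: measurable_funB => //; exact: mR.
apply: measurable_prod => j; rewrite mem_index_iota => /andP[_ jt]; apply: mR.
by rewrite ltnW// (leq_trans jt).
Qed.

(** * Deterministic propagation of relative errors *)

Lemma prod_relative_error (R : realFieldType) (r rho : nat -> R) (u : R) (t : nat) :
  0 <= u -> 2 * t%:R * u <= 1 ->
  (forall j, (j < t)%N -> 0 <= r j) ->
  (forall j, (j < t)%N -> `|rho j - r j| <= u * r j) ->
  (1 - t%:R * u) * \prod_(0 <= j < t) r j <= \prod_(0 <= j < t) rho j
  <= (1 + 2 * t%:R * u) * \prod_(0 <= j < t) r j.
Proof.
move=> u0; elim: t => [|t ih] tu r0 hrho.
  by rewrite !big_geq//; apply/andP; split; lra.
rewrite !big_nat_recr//=.
have t0 : 0 <= t%:R :> R by [].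
rewrite -natr1 in tu *.
have tu' : 2 * t%:R * u <= 1 by nra.
have /andP[h1 h2] := ih tu' (fun j jt => r0 j (ltnW jt)) (fun j jt => hrho j (ltnW jt)).
have := hrho t (ltnSn t); rewrite ler_norml => /andP[h3 h4].
have rt0 := r0 t (ltnSn t).
have p0 : 0 <= \prod_(0 <= j < t) r j.
  by rewrite big_nat; apply: prodr_ge0 => j /andP[_ jt]; exact: r0 (ltnW jt).
move: h1 h2 p0; set p := \prod_(0 <= j < t) r j; set q := \prod_(0 <= j < t) rho j.
move=> h1 h2 p0.
have u1 : u <= 1/2 by nra.
have h5 : 0 <= (1 - u) * r t by rewrite mulr_ge0//; lra.
have h6 : 0 <= (1 - t%:R * u) * p by rewrite mulr_ge0//; lra.
have h7 : (1 - u) * r t <= rho t by lra.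
have h8 : rho t <= (1 + u) * r t by lra.
have pr0 : 0 <= p * r t by rewrite mulr_ge0.
apply/andP; split.
  apply: (le_trans _ (ler_pM h6 h5 h1 h7)).
  rewrite -subr_ge0 (_ : _ - _ = t%:R * u ^+ 2 * (p * r t)); last by ring.
  by rewrite mulr_ge0// mulr_ge0// sqr_ge0.
apply: (le_trans (ler_pM (le_trans h6 h1) (le_trans h5 h7) h2 h8)).
(* The condition [2 * t * u <= 1] is what keeps the upper factor linear in [t] through the
   induction. *)
rewrite -subr_ge0 (_ : _ - _ = u * (1 - 2 * t%:R * u) * (p * r t)); last by ring.
by rewrite mulr_ge0// mulr_ge0//; lra.
Qed.

Lemma expR_ln_tail (R : realType) (y e : R) : 0 < y -> ln y <= e ->
  expR (- e) <= y^-1.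
Proof.
move=> y0 h; rewrite -[y in _ <= y^-1]lnK ?posrE// -expRN ler_expR lerN2//.
Qed.

(** An error proportional to [min (r j) (1 - r j)] is a relative error for both [rho j] and
    [1 - rho j]. All terms are nonnegative, so a relative error common to the terms passes to the
    sum. *)
Lemma stratified_sum_error (R : realFieldType) (n : nat) (eps : R)
    (r rho m Phi : nat -> R) :
  0 < eps < 1 -> (0 < n)%N ->
  (forall j, (j <= n)%N -> 0 <= r j <= 1) ->
  (forall j, (j <= n)%N ->
    `|rho j - r j| <= 3 / 32 * eps / n%:R * Num.min (r j) (1 - r j)) ->
  (forall t, (1 <= t <= n)%N -> 0 <= m t) ->
  (forall t, (1 <= t <= n)%N -> `|Phi t - m t| <= 9 / 32 * eps * m t) ->
  let z := \sum_(1 <= t < n.+1) m t * ((1 - r t) * \prod_(0 <= j < t) r j) in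
  z * (1 - eps)
  <= \sum_(1 <= t < n.+1) Phi t * ((1 - rho t) * \prod_(0 <= j < t) rho j)
  <= z * (1 + eps).
Proof.
move=> /andP[e0 e1] n0 hr hrho m0 hPhi /=.
(* A product of at most [n] factors then loses at most [3/32 * eps] and gains at most [3/16 * eps],
   relatively. *)
set u := 3 / 32 * eps / n%:R in hrho.
have n0' : 0 < n%:R :> R by rewrite ltr0n.
have u0 : 0 <= u by rewrite /u divr_ge0//; lra.
have un : n%:R * u = 3 / 32 * eps by rewrite /u mulrC divfK// gt_eqF.
have tu t : (t <= n)%N -> t%:R * u <= 3 / 32 * eps.
  by move=> tn; rewrite -un ler_wpM2r// ler_nat.
have err j : (j <= n)%N ->
    `|rho j - r j| <= u * r j /\ `|rho j - r j| <= u * (1 - r j).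
  move=> jn; have h := hrho j jn.
  by split; apply: (le_trans h); rewrite ler_wpM2l// ge_min lexx ?orbT.
have term t : (1 <= t <= n)%N ->
    m t * ((1 - r t) * \prod_(0 <= j < t) r j) * (1 - eps)
    <= Phi t * ((1 - rho t) * \prod_(0 <= j < t) rho j)
    <= m t * ((1 - r t) * \prod_(0 <= j < t) r j) * (1 + eps).
  move=> /[dup] t1n /andP[t1 tn].
  have jtn j : (j < t)%N -> (j <= n)%N by move=> /ltnW /leq_trans; apply.
  have tu2 : 2 * t%:R * u <= 1 by have := tu t tn; lra.
  have r0 j : (j < t)%N -> 0 <= r j by move=> /jtn jn; have /andP[] := hr j jn.
  have rj j : (j < t)%N -> `|rho j - r j| <= u * r j.
    by move=> /jtn jn; have [] := err j jn.
  have := prod_relative_error u0 tu2 r0 rj.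
  set p := \prod_(0 <= j < t) r j; set q := \prod_(0 <= j < t) rho j.
  have p0 : 0 <= p.
    by rewrite /p big_nat; apply: prodr_ge0 => j /andP[_ /r0].
  have tut := tu t tn => /andP[q1 q2].
  have {}q1 : (1 - 3 / 32 * eps) * p <= q.
    by apply: le_trans q1; rewrite ler_wpM2r//; lra.
  have {}q2 : q <= (1 + 3 / 16 * eps) * p.
    by apply: (le_trans q2); rewrite ler_wpM2r//; lra.
  have u1 : u <= 3 / 32 * eps.
    by apply: le_trans (tu t tn); rewrite ler_peMl// ler1n.
  have /andP[_ rt1] := hr t tn.
  have c0 : 0 <= 1 - r t by rewrite subr_ge0.
  have [_] := err t tn; rewrite ler_norml => /andP[v1 v2].
  have w : u * (1 - r t) <= 3 / 32 * eps * (1 - r t) by rewrite ler_wpM2r.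
  have s1 : (1 - 3 / 32 * eps) * (1 - r t) <= 1 - rho t by lra.
  have s2 : 1 - rho t <= (1 + 3 / 32 * eps) * (1 - r t) by lra.
  have := hPhi t t1n; rewrite ler_norml => /andP[f1 f2].
  have mt := m0 t t1n.
  have g1 : (1 - 9 / 32 * eps) * m t <= Phi t by lra.
  have g2 : Phi t <= (1 + 9 / 32 * eps) * m t by lra.
  have q0 : 0 <= (1 - 3 / 32 * eps) * p by rewrite mulr_ge0//; lra.
  have s0 : 0 <= (1 - 3 / 32 * eps) * (1 - r t) by rewrite mulr_ge0//; lra.
  have g0 : 0 <= (1 - 9 / 32 * eps) * m t by rewrite mulr_ge0//; lra.
  have P0 : 0 <= m t * ((1 - r t) * p) by rewrite !mulr_ge0.
  (* The first-order coefficients sum to [9/32 + 3/32 + 3/32 = 15/32] below and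
     [9/32 + 3/32 + 3/16 = 9/16] above; the rest of [eps] absorbs the higher orders. *)
  apply/andP; split.
    apply: (le_trans _ (ler_pM g0 (mulr_ge0 s0 q0) g1 (ler_pM s0 q0 s1 q1))).
    rewrite [leRHS](_ : _ = m t * ((1 - r t) * p) *
      ((1 - 9 / 32 * eps) * ((1 - 3 / 32 * eps) * (1 - 3 / 32 * eps)))); last by ring.
    by rewrite ler_wpM2l//; nra.
  have q0' := le_trans q0 q1; have s0' := le_trans s0 s1.
  apply: (le_trans (ler_pM (le_trans g0 g1) (mulr_ge0 s0' q0') g2
    (ler_pM s0' q0' s2 q2))).
  rewrite [leLHS](_ : _ = m t * ((1 - r t) * p) *
    ((1 + 9 / 32 * eps) * ((1 + 3 / 32 * eps) * (1 + 3 / 16 * eps)))); last by ring.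
  by rewrite ler_wpM2l//; nra.
rewrite !mulr_suml !big_nat; apply/andP; split; apply: ler_sum => t t1n.
  by have /andP[] := term t t1n.
by have /andP[] := term t t1n.
Qed.

(** * Error events of a single stage, with explicit constants *)

Section stage_errors.
Context dV dW dT (V : measurableType dV) (W : measurableType dW)
  (T : measurableType dT) (R : realType).
Variables (Pf : probability V R) (X : {RV Pf >-> T}) (P : probability W R).
Variables (eps delta : R) (n : nat).
Hypotheses (heps : 0 < eps < 1) (hdelta : 0 < delta < 1) (n0 : (0 < n)%N).

Let n0' : 0 < n%:R :> R. Proof. by rewrite ltr0n. Qed.
Let n1 : 1 <= n%:R :> R. Proof. by rewrite ler1n. Qed.

Lemma stage_frequency_error (A C : set T) (N : nat) (x : 'I_N -> {RV P >-> T})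
    (mu : probability T R) :
  let rmin := Num.min (cond_law X A C) (1 - cond_law X A C) in
  measurable A -> measurable C -> C `<=` A ->
  (0 < N)%N -> iid_sample x mu -> 0 < rmin ->
  tv_dist (fun B => fine (mu B)) (cond_law X A) <= eps * rmin / (32 * n%:R) ->
  3072 * n%:R ^+ 2 * ln (4 * n%:R ^+ 2 / delta) / (eps ^+ 2 * rmin ^+ 2) <= N%:R ->
  exists F, [/\ measurable F, (P F <= (delta / (2 * n%:R))%:E)%E &
    forall w, ~ F w ->
      `|#|~: hits (A `\` C) x w|%:R / N%:R - cond_law X A C|
      <= 3 / 32 * eps / n%:R * rmin].
Proof.
move=> rmin mA mC CA N0 iidx rmin0 htv hN.
have /andP[e0 e1] := heps; have /andP[d0 d1] := hdelta.
have mB : measurable (A `\` C) by exact: measurableD.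
(* Fluctuation [1/16] and bias [1/32] add up to [3/32]. The exponent [N * s ^ 2 / 4] is at least
   [3 * ln (4 * n ^ 2 / delta)], more than the single logarithm used below. *)
pose s := eps * rmin / (16 * n%:R).
have s0 : 0 < s by rewrite divr_gt0 ?mulr_gt0.
have [F [mF PF hF]] := hit_frequency_concentration mB N0 iidx s0.
exists F; split => //.
  apply: (le_trans PF); rewrite lee_fin.
  have y0 : 0 < 4 * n%:R ^+ 2 / delta by rewrite divr_gt0// mulr_gt0// exprn_gt0.
  have y1 : 1 <= 4 * n%:R ^+ 2 / delta.
    have : 1 <= n%:R ^+ 2 :> R by exact: exprn_ege1.
    by rewrite ler_pdivlMr// mul1r; lra.
  have L0 := ln_ge0 y1.
  have h : ln (4 * n%:R ^+ 2 / delta) <= N%:R * (s ^+ 2 / 4).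
    set L := ln _ in L0 hN *.
    pose e := eps ^+ 2 * rmin ^+ 2 / n%:R ^+ 2.
    have e0' : 0 <= e by apply: divr_ge0; rewrite ?sqr_ge0// -exprMn sqr_ge0.
    have : 3072 * L <= N%:R * e.
      rewrite (_ : 3072 * L =
          3072 * n%:R ^+ 2 * L / (eps ^+ 2 * rmin ^+ 2) * e).
        by rewrite ler_wpM2r.
      by rewrite /e; field; rewrite !gt_eqF.
    have -> : s ^+ 2 / 4 = e / 1024 by rewrite /s /e; field; rewrite gt_eqF.
    by lra.
  apply: (@le_trans _ _ (2 * (4 * n%:R ^+ 2 / delta)^-1)).
    by rewrite ler_pM2l//; apply: expR_ln_tail => //; exact: h.
  rewrite invf_div (_ : 2 * _ = delta / (2 * n%:R) / n%:R); last first.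
    by field; rewrite gt_eqF.
  by rewrite ler_pdivrMr// ler_peMr// divr_ge0 ?mulr_ge0// ltW.
move=> w /hF h1.
have h2 : `|fine (mu (~` (A `\` C))) - cond_law X A C| <= eps * rmin / (32 * n%:R).
  apply: le_trans htv.
  (* The two sets have the same trace on [A]. *)
  have -> : cond_law X A C = cond_law X A (~` (A `\` C)).
    rewrite /cond_law; congr (fine (distribution Pf X _) / _).
    apply/seteqP; split => y /=.
      by move=> [Cy Ay]; split => // -[_].
    by move=> [nB Ay]; split => //; apply: contrapT => nC; apply: nB.
  apply: (le_tv_dist (alpha := fun B => fine (mu B))).
  - move=> D mD; rewrite fine_ge0//= -lee_fin fineK ?fin_num_measure//.
    exact: probability_le1.
  - by move=> D mD; exact: cond_law_itv.
  - exact: measurableC.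
apply: (le_trans (ler_distD (fine (mu (~` (A `\` C)))) _ _)).
apply: (le_trans (lerD h1 h2)); rewrite le_eqVlt; apply/orP; left; apply/eqP.
by rewrite /s; field; rewrite gt_eqF.
Qed.

(** This serves the last stage, whose layer is all of the preceding set: there the target
    probability is 0 and the estimate is almost surely exact. *)
Lemma all_hits_ae (B : set T) (N : nat) (x : 'I_N -> {RV P >-> T})
    (mu : probability T R) :
  measurable B -> iid_sample x mu -> mu B = 1%E ->
  exists F, [/\ measurable F, P F = 0%E &
    forall w, ~ F w -> hits B x w = [set: 'I_N]%SET].
Proof.
move=> mB iidx muB; exists (~` [set w | hits B x w = [set: 'I_N]%SET]).
have mH := measurable_hits x mB [set: 'I_N]%SET.
split; [exact: measurableC| |by move=> w /contrapT].
rewrite probability_setC// (_ : [set w | _] =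
  \bigcap_(i in [set: 'I_N]) (x i @^-1` B)).
  by rewrite iidx// big1// subee.
apply/seteqP; split => w /=.
  by move=> h i _ /=; have := finset.in_setT i; rewrite -h inE => /set_mem.
by move=> h; apply/setP => i; rewrite !inE; apply: mem_set; exact: h.
Qed.

Lemma stage_average_error (B : set T) (N : nat) (x : 'I_N -> {RV P >-> T})
    (nu : probability T R) (phi : T -> R) (a b : R) :
  measurable B -> (0 < distribution Pf X B)%E -> measurable_fun B phi ->
  0 < a -> is_minimum (phi @` B) a -> is_maximum (phi @` B) b ->
  iid_hits B x nu ->
  (a < b -> tv_dist (fun A => fine (nu A)) (cond_law X B)
     <= eps * a / (16 * (b - a))) ->
  exists m F, [/\ a <= m,
    (\int[Pf]_(v in X @^-1` B) (phi (X v))%:E)%E =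
      (m * fine (distribution Pf X B))%:E,
    measurable F, (P F <= (delta / (2 * n%:R))%:E)%E &
    forall w, ~ F w -> (0 < #|hits B x w|)%N ->
      128 * (b - a) ^+ 2 * ln (4 * n%:R / delta) / (eps ^+ 2 * a ^+ 2)
        <= #|hits B x w|%:R ->
      `|#|hits B x w|%:R^-1 * \sum_(i in hits B x w) phi (x i w) - m|
      <= 9 / 32 * eps * m].
Proof.
move=> mB B0 mphi a0 [_ hmin] [_ hmax] iidx htv.
have /andP[e0 e1] := heps; have /andP[d0 d1] := hdelta.
have hphi y : B y -> a <= phi y <= b.
  by move=> By; apply/andP; split; [apply: hmin|apply: hmax]; exists y.
have [m [/andP[am mb] mI hm]] := cond_mean_discretized mB B0 mphi (ltW a0) hphi.
have dn0 : 0 <= delta / (2 * n%:R) by rewrite divr_ge0 ?mulr_ge0// ltW.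
have m0 : 0 <= m by rewrite (le_trans _ am)// ltW.
(* If [a = b], then [phi] is constant on [B] and every nonempty average is exact, so no exceptional
   event is required. *)
case: (ltP a b) => [ab|ba]; last first.
  exists m, set0; split => //; first by rewrite measure0.
  move=> w _ H0 _.
  rewrite (eq_bigr (fun=> m)); last first.
    move=> i; rewrite inE => /set_mem /hphi /andP[? ?].
    by apply/eqP; rewrite eq_le; apply/andP; split; lra.
  rewrite sumr_const -[m *+ _]mulr_natr mulrCA mulVf ?mulr1.
    by rewrite subrr normr0 mulr_ge0// mulr_ge0 ?ltW//; lra.
  by rewrite pnatr_eq0 -lt0n.
have y1 : 1 < 4 * n%:R / delta by have := n1; rewrite ltr_pdivlMr// mul1r; lra.
have L0 := ln_gt0 y1.
have c0 : 0 < b - a by rewrite subr_gt0.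
set k := 128 * _ * _ / _.
have k0 : 0 < k by rewrite /k divr_gt0// ?mulr_gt0// exprn_gt0.
(* With [eta] below and the bias [1/16], the error is [3/16 + 2/64 + 1/16 = 9/32] times [eps * a],
   and [a <= m] makes it relative. The exponent becomes [9/8] of the logarithm. *)
pose s := 3 / 16 * eps * a.
pose eta := eps * a / 64.
have s0 : 0 < s by rewrite /s !mulr_gt0//; lra.
have eta0 : 0 < eta by rewrite /eta divr_gt0// mulr_gt0.
have [F [mF PF hF]] := hit_average_concentration mB B0 iidx mphi (ltW a0) ab
  hphi s0 eta0 k0 (hm eta).
exists m, F; split => //.
  apply: (le_trans PF); rewrite lee_fin.
  rewrite (_ : delta / (2 * n%:R) = 2 * (4 * n%:R / delta)^-1); last first.
    by field; rewrite !gt_eqF.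
  rewrite ler_pM2l//; apply: expR_ln_tail; first exact: lt_trans y1.
  rewrite (_ : k * _ = 9 / 8 * ln (4 * n%:R / delta)); last first.
    by rewrite /k /s; field; rewrite !gt_eqF.
  by lra.
move=> w nF _ /(hF w nF) h; apply: (le_trans h).
have t : (b - a) * tv_dist (fun A => fine (nu A)) (cond_law X B) <= eps * a / 16.
  rewrite (_ : eps * a / 16 = (b - a) * (eps * a / (16 * (b - a)))).
    by rewrite ler_pM2l//; exact: htv.
  by field; rewrite gt_eqF.
have : eps * a <= eps * m by rewrite ler_pM2l.
by rewrite /s /eta; lra.
Qed.

End stage_errors.

(** * Assembly over the stages and the union bound *)

(** The guard [0 < stage_min] excludes the last stage, where [XX n] is empty and the minimum is 0;
    the guard [a t < b t] reads a bound with zero denominator as infinite. The number of hits is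
    random, so its lower bound is a premise inside the event. *)
Theorem theorem2 (R : realType) (d : nat)
    (eps delta : R) (heps : 0 < eps < 1) (hdelta : 0 < delta < 1)
    (* the target: X ~ f with values in X_0 *)
    (dV : measure_display) (V : measurableType dV) (Pf : probability V R)
    (X : {RV Pf >-> d.-tuple R})
    (m : {measure set (d.-tuple R) -> \bar R})
    (hm : is_lebesgue m \/ is_counting m)
    (f : d.-tuple R -> R) (hf : has_density X m f)
    (n : nat) (XX : nat -> set (d.-tuple R))
    (hXval : forall v, XX 0%N (X v))
    (hXXmeas : forall t, (t <= n)%N -> measurable (XX t))
    (hXXdec : forall t, (1 <= t <= n)%N -> XX t `<=` XX t.-1)
    (hXXn : XX n = set0)
    (hposX : forall t, (1 <= t <= n)%N -> (0 < distribution Pf X (XX t.-1))%E)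
    (hposZ : forall t, (1 <= t <= n)%N -> (0 < distribution Pf X (layer XX t))%E)
    (phi : d.-tuple R -> R)
    (hphimeas : measurable_fun (XX 0%N) phi)
    (hphipos : forall x, XX 0%N x -> 0 < phi x)
    (a b : nat -> R)
    (ha : forall t, (1 <= t <= n)%N -> is_minimum (phi @` layer XX t) (a t))
    (hb : forall t, (1 <= t <= n)%N -> is_maximum (phi @` layer XX t) (b t))
    (* the algorithm *)
    (dW : measure_display) (W : measurableType dW) (P : probability W R)
    (N : nat -> nat) (hN : forall t, (1 <= t <= n)%N -> (0 < N t)%N)
    (x : forall t : nat, 'I_(N t) -> {RV P >-> d.-tuple R})
    (muhat nuhat : nat -> probability (d.-tuple R) R)
    (hmuhat : forall t, (1 <= t <= n)%N -> muhat t (XX t.-1) = 1%E)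
    (hnuhat : forall t, (1 <= t <= n)%N -> nuhat t (layer XX t) = 1%E)
    (hiidX : forall t, (1 <= t <= n)%N -> iid_sample (x t) (muhat t))
    (hiidZ : forall t, (1 <= t <= n)%N ->
       iid_hits (layer XX t) (x t) (nuhat t))
    (* condition 1 *)
    (hmuTV : forall t, (1 <= t <= n)%N -> 0 < stage_min X XX t ->
       tv_dist (fun A => fine (muhat t A)) (cond_law X (XX t.-1))
         <= eps * stage_min X XX t / (32 * n%:R))
    (hsizeX : forall t, (1 <= t <= n)%N -> 0 < stage_min X XX t ->
       3072 * n%:R ^+ 2 * ln (4 * n%:R ^+ 2 / delta)
         / (eps ^+ 2 * stage_min X XX t ^+ 2) <= (N t)%:R)
    (* condition 2; the size requirement is part of the event below *)
    (hnuTV : forall t, (1 <= t <= n)%N -> a t < b t ->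
       tv_dist (fun A => fine (nuhat t A)) (cond_law X (layer XX t))
         <= eps * a t / (16 * (b t - a t))) :
  let z := ('E_Pf[phi \o X])%E in
  ((1 - delta)%:E <=
   P [set w |
       (forall t, (1 <= t <= n)%N ->
          (128 * (b t - a t) ^+ 2 * ln (4 * n%:R / delta)
            / (eps ^+ 2 * a t ^+ 2) <= #|layer_hits XX x t w|%:R)%R) ->
       z * (1 - eps)%:E <= (issa_output phi XX x n w)%:E <= z * (1 + eps)%:E])%E.
Proof.
(* For [n = 0] the empty set [XX n] would contain all values of [X]. *)
have n0 : (0 < n)%N.
  rewrite lt0n; apply/negP => /eqP ne.
  have V0 : [set: V] = set0.
    by apply/seteqP; split => // v _; have := hXval v; rewrite -ne hXXn.
  by have := probability_setT Pf; rewrite V0 measure0 => /eqP; rewrite eqe eq_sym oner_eq0.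
have /andP[e0 e1] := heps; have /andP[d0 d1] := hdelta.
have n0' : 0 < n%:R :> R by rewrite ltr0n.
have tn_le t : (1 <= t <= n)%N -> (t.-1 <= n)%N.
  by move=> /andP[_]; apply: leq_trans; exact: leq_pred.
have XXle s t : (s <= t <= n)%N -> XX t `<=` XX s.
  elim: t => [|t ih]; first by rewrite leqn0 => /andP[/eqP-> _] y.
  move=> /andP[]; rewrite leq_eqVlt => /orP[/eqP-> _ y//|st tn].
  by apply: (subset_trans (hXXdec t.+1 tn)); apply: ih; rewrite -ltnS st ltnW.
have mL t : (1 <= t <= n)%N -> measurable (layer XX t).
  move=> t1n; apply: measurableD; apply: hXXmeas; first exact: tn_le.
  by case/andP: t1n.
have LX0 t : (1 <= t <= n)%N -> layer XX t `<=` XX 0%N.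
  by move=> t1n y [+ _]; apply: XXle; rewrite tn_le.
have mphi t : (1 <= t <= n)%N -> measurable_fun (layer XX t) phi.
  by move=> t1n; apply: measurable_funS hphimeas; [exact: hXXmeas|exact: LX0].
have a0 t : (1 <= t <= n)%N -> 0 < a t.
  by move=> t1n; have [[y Ly <-] _] := ha _ t1n; apply: hphipos; exact: LX0 Ly.
pose px t := fine (distribution Pf X (XX t)).
pose pl t := fine (distribution Pf X (layer XX t)).
pose r := stage_prob X XX.
have fpos A : measurable A -> (0 < distribution Pf X A)%E ->
    0 < fine (distribution Pf X A).
  by move=> mA A0; rewrite fine_gt0// A0/= ltey_eq fin_num_measure.
have px_gt0 t : (1 <= t <= n)%N -> 0 < px t.-1.
  by move=> t1n; apply: fpos (hposX _ t1n); apply: hXXmeas; exact: tn_le.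
have pl_gt0 t : (1 <= t <= n)%N -> 0 < pl t.
  by move=> t1n; apply: fpos (hposZ _ t1n); exact: mL.
have px0 : px 0%N = 1.
  rewrite /px (_ : distribution Pf X (XX 0%N) = 1%E)//.
  rewrite -(probability_setT Pf); congr (Pf _).
  by apply/seteqP; split => v // _; exact: hXval.
have plE t : (1 <= t <= n)%N -> pl t = px t.-1 - px t.
  move=> t1n; have /andP[_ tn] := t1n.
  have mt := hXXmeas _ tn.
  have -> : px t.-1 = pl t + px t.
    rewrite /px /pl -fineD ?fin_num_measure//; last exact: mL.
    rewrite -measureU//; [|exact: mL|].
      by congr (fine _); rewrite /layer setUC setDUK//; exact: hXXdec.
    by apply/seteqP; split => y // [[_ nX] Xy]; exact: nX.
  by rewrite addrK.
(* The predecessor of 0 is 0, so this conditions [XX 0] on itself. *)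
have r0E : r 0%N = 1.
  by rewrite /r /stage_prob /cond_law setIid divff// -/(px 0%N) px0 oner_eq0.
have rE t : (1 <= t <= n)%N -> r t = px t / px t.-1.
  by move=> t1n; rewrite /r /stage_prob /cond_law (setIidl (hXXdec _ t1n)).
have r1E t : (1 <= t <= n)%N -> 1 - r t = pl t / px t.-1.
  by move=> t1n; rewrite rE// plE// mulrBl divff// gt_eqF// px_gt0.
have rn0 : r n = 0.
  by rewrite rE ?n0 ?leqnn// /px hXXn measure0 mul0r.
have prodE t : (t < n)%N -> \prod_(0 <= j < t.+1) r j = px t.
  elim: t => [_|t ih tn]; first by rewrite big_nat1 r0E px0.
  rewrite big_nat_recr//= ih 1?ltnW// rE//=; last by rewrite ltnW.
  by rewrite mulrC divfK// gt_eqF// (px_gt0 t.+1)//= ltnW.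
have r01 t : (t <= n)%N -> 0 <= r t <= 1.
  by move=> tn; apply: cond_law_itv; apply: hXXmeas => //; exact: leq_trans (leq_pred _) tn.
have r_lt1 t : (1 <= t <= n)%N -> r t < 1.
  by move=> t1n; rewrite -subr_gt0 r1E// divr_gt0 ?pl_gt0 ?px_gt0.
have r_gt0 t : (1 <= t < n)%N -> 0 < r t.
  move=> /andP[t1 tn]; rewrite rE ?t1 1?ltnW// divr_gt0//.
    exact: (px_gt0 t.+1).
  by apply: px_gt0; rewrite t1 ltnW.
have rmin_gt0 t : (1 <= t < n)%N -> 0 < stage_min X XX t.
  move=> /[dup] t1n /andP[t1 tn]; rewrite lt_min subr_gt0 r_gt0//= r_lt1//.
  by rewrite t1 ltnW.
have freq t : exists F : set W, (1 <= t <= n)%N ->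
    [/\ measurable F, (P F <= (delta / (2 * n%:R))%:E)%E &
      forall w, ~ F w -> `|Rhat XX x t w - r t|
        <= 3 / 32 * eps / n%:R * Num.min (r t) (1 - r t)].
  have [t1n|] := boolP (1 <= t <= n)%N; last by exists set0.
  have [t1 tn] := andP t1n.
  have RE w : Rhat XX x t w = #|~: layer_hits XX x t w|%:R / (N t)%:R.
    by rewrite /Rhat gtn_eqF.
  (* At [t = n] the admissible error is 0, and almost surely every sample hits the layer. *)
  have [tn'|] := ltnP t n; last first.
    move=> nt; have tE : t = n by apply/eqP; rewrite eqn_leq tn nt.
    have muL : muhat t (layer XX t) = 1%E.
      by rewrite -(hmuhat _ t1n); congr (muhat t _); rewrite /layer tE hXXn setD0.
    have [F [mF PF hF]] := all_hits_ae (mL _ t1n) (hiidX _ t1n) muL.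
    exists F => _; split => //.
      by rewrite PF lee_fin divr_ge0// ?mulr_ge0// ltW.
    move=> w /hF h; rewrite RE /layer_hits h finset.setCT cards0 mul0r.
    by rewrite tE rn0 subrr normr0 subr0 (min_idPl _)// mulr0.
  have t1n' : (1 <= t < n)%N by rewrite t1.
  have [F [mF PF hF]] := stage_frequency_error heps hdelta n0
    (hXXmeas _ (tn_le _ t1n)) (hXXmeas _ tn) (hXXdec _ t1n) (hN _ t1n) (hiidX _ t1n)
    (rmin_gt0 _ t1n') (hmuTV _ t1n (rmin_gt0 _ t1n')) (hsizeX _ t1n (rmin_gt0 _ t1n')).
  by exists F => _; split => // w nF; rewrite RE; exact: hF.
have avg t : exists mF : R * set W, (1 <= t <= n)%N ->
    [/\ a t <= mF.1,
      (\int[Pf]_(v in X @^-1` layer XX t) (phi (X v))%:E)%E = (mF.1 * pl t)%:E,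
      measurable mF.2, (P mF.2 <= (delta / (2 * n%:R))%:E)%E &
      forall w, ~ mF.2 w -> (0 < #|layer_hits XX x t w|)%N ->
        128 * (b t - a t) ^+ 2 * ln (4 * n%:R / delta) / (eps ^+ 2 * a t ^+ 2)
          <= #|layer_hits XX x t w|%:R ->
        `|Phihat phi XX x t w - mF.1| <= 9 / 32 * eps * mF.1].
  have [t1n|] := boolP (1 <= t <= n)%N; last by exists (0, set0).
  have [q [F [h1 h2 h3 h4 h5]]] := stage_average_error heps hdelta n0 (mL _ t1n)
    (hposZ _ t1n) (mphi _ t1n) (a0 _ t1n) (ha _ t1n) (hb _ t1n) (hiidZ _ t1n) (hnuTV _ t1n).
  by exists (q, F).
have [F hF] := choice freq.
have [G hG] := choice avg.
lazy zeta; set z := ('E_Pf[_])%E.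
pose zr := \sum_(1 <= t < n.+1) (G t).1 * ((1 - r t) * \prod_(0 <= j < t) r j).
have zE : z = zr%:E.
  (* Each value lies in the layer of the first [t] for which it is outside [XX t]. *)
  have UL : [set: V] = \big[setU/set0]_(i <- enum 'I_n) X @^-1` layer XX i.+1.
    rewrite -bigcup_seq; apply/seteqP; split => v // _.
    have exn : exists t, `[< ~ XX t (X v) >] by exists n; apply/asboolP; rewrite hXXn.
    case: (ex_minnP exn) => -[|t] /asboolP nX tmin; first by have := hXval v.
    have tn : (t < n)%N by apply: tmin; apply/asboolP; rewrite hXXn.
    exists (Ordinal tn); rewrite /= ?mem_enum//; split => //=.
    apply: contrapT => /asboolP /tmin; by rewrite ltnn.
  have mXphi : measurable_fun setT (fun v => phi (X v)).
    rewrite (_ : (fun v => _) = (phi \_ (XX 0%N)) \o X).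
      apply: measurableT_comp => //.
      exact: (measurable_restrictT phi (hXXmeas _ (leq0n n))).1 hphimeas.
    by apply/funext => v /=; rewrite patchE mem_set.
  rewrite /z unlock UL ge0_integral_bigsetU/=; first last.
  - by move=> v _; rewrite lee_fin ltW// hphipos.
  - rewrite -UL; exact/measurable_EFinP.
  - move=> i j _ _ [v [[/= Xi nXi] [/= Xj nXj]]].
    apply/val_inj/eqP; rewrite /= eqn_leq; apply/andP; split; rewrite leqNgt.
      apply/negP => ij; apply: nXj; apply: XXle Xi; rewrite /= ij ltnW//.
    apply/negP => ij; apply: nXi; apply: XXle Xj; rewrite /= ij ltnW//.
  - exact: enum_uniq.
  - move=> i; rewrite -[X in measurable X]setTI; apply: measurable_funPT => //.
    exact: (mL i.+1 (ltn_ord i)).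
  rewrite big_enum/= /zr big_add1 big_mkord -sumEFin; apply: eq_bigr => i _.
  have [_ -> _ _ _] := hG i.+1 (ltn_ord i); congr (_ * _)%:E.
  by rewrite prodE// r1E ?ltn_ord// divfK// gt_eqF// (px_gt0 i.+1)// ltn_ord.
have hmain w : (forall t, (1 <= t <= n)%N -> ~ F t w /\ ~ (G t).2 w) ->
    (forall t, (1 <= t <= n)%N ->
      128 * (b t - a t) ^+ 2 * ln (4 * n%:R / delta) / (eps ^+ 2 * a t ^+ 2)
        <= #|layer_hits XX x t w|%:R) ->
    zr * (1 - eps) <= issa_output phi XX x n w <= zr * (1 + eps).
  move=> good hsize.
  have RF j : (j <= n)%N -> `|Rhat XX x j w - r j|
      <= 3 / 32 * eps / n%:R * Num.min (r j) (1 - r j).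
    case: j => [_|j jn].
      rewrite r0E /Rhat eqxx subrr normr0; apply: mulr_ge0.
        by rewrite divr_ge0//; lra.
      by rewrite le_min ler01/=.
    have [_ _] := hF j.+1 jn; apply; by have [] := good j.+1 jn.
  apply: (stratified_sum_error heps n0 r01 RF).
    by move=> t t1n; have [h _ _ _ _] := hG t t1n; rewrite (le_trans _ h)// ltW// a0.
  move=> t t1n; have [_ _ _ _] := hG t t1n; apply.
  - by have [] := good t t1n.
  (* Without hits [Rhat] would be 1, a relative error of 100 percent for [1 - r t], which the
     frequency bound forbids. *)
  - rewrite lt0n; apply/negP => /eqP h0.
    have R1 : Rhat XX x t w = 1.
      have /andP[t1 _] := t1n.
      rewrite /Rhat gtn_eqF// cardsCs finset.setCK h0 subn0 card_ord.
      by rewrite divff// pnatr_eq0 -lt0n hN.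
    have /andP[_ tn] := t1n; have := RF t tn.
    have rt := r_lt1 t t1n.
    rewrite R1 gtr0_norm ?subr_gt0// leNgt => /negP; apply.
    apply: (@le_lt_trans _ _ (3 / 32 * eps / n%:R * (1 - r t))).
      by rewrite ler_wpM2l ?ge_min ?lexx ?orbT// divr_ge0//; lra.
    rewrite gtr_pMl ?subr_gt0// ltr_pdivrMr// mul1r.
    by apply: (@lt_le_trans _ _ 1); [lra|rewrite ler1n].
  - exact: hsize.
pose size_ok := \bigcap_(i in [set: 'I_n]) [set w |
  128 * (b i.+1 - a i.+1) ^+ 2 * ln (4 * n%:R / delta) / (eps ^+ 2 * a i.+1 ^+ 2)
    <= #|layer_hits XX x i.+1 w|%:R].
have msize : measurable size_ok.
  apply: fin_bigcap_measurable => // i _.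
  rewrite -[X in measurable X]setTI.
  rewrite (_ : [set w | _] = (fun w => #|hits (layer XX i.+1) (x i.+1) w|%:R) @^-1`
    `[128 * (b i.+1 - a i.+1) ^+ 2 * ln (4 * n%:R / delta)
      / (eps ^+ 2 * a i.+1 ^+ 2), +oo[); last first.
    by apply/seteqP; split => w /=; rewrite in_itv/= andbT.
  exact: (@measurable_fun_hits _ _ _ _ _ P _ _ (x i.+1) (fun S => #|S|%:R)
    (mL i.+1 (ltn_ord i))).
set M := [set w | _].
(* This form shows that [M] is measurable, which passing to the complement requires. *)
have ME : M = ~` size_ok `|`
    issa_output phi XX x n @^-1` `[zr * (1 - eps), zr * (1 + eps)].
  apply/seteqP; split => w.
    move=> h; have [ok|nok] := pselect (size_ok w); last by left.
    right; move: h; rewrite /M /= zE -!EFinM !lee_fin in_itv/=; apply => t t1n.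
    by case: t t1n => // t tn; exact: (ok (Ordinal tn)).
  move=> h; rewrite /M/= zE -!EFinM !lee_fin => hs.
  by case: h => [nok|]; [exfalso; apply: nok => i _; apply: hs; rewrite ltn_ord|rewrite /= in_itv].
have mM : measurable M.
  rewrite ME; apply: measurableU; first exact: measurableC.
  by rewrite -[X in measurable X]setTI; apply: measurable_issa_output.
pose bad := \big[setU/set0]_(i < n) (F i.+1 `|` (G i.+1).2).
have mFG (i : 'I_n) : measurable (F i.+1 `|` (G i.+1).2).
  have [mF _ _] := hF i.+1 (ltn_ord i); have [_ _ mG _ _] := hG i.+1 (ltn_ord i).
  exact: measurableU.
have mbad : measurable bad by exact: bigsetU_measurable.
have badM : ~` M `<=` bad.
  move=> w nM; apply: contrapT => nbad; apply: nM.
  rewrite /M /= => hs; rewrite zE -!EFinM !lee_fin; apply: hmain => //.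
  case=> // t tn.
  have nb : ~ (F t.+1 `|` (G t.+1).2) w.
    move=> h; apply: nbad; rewrite /bad.
    rewrite -(bigcup_mkord n (fun i => F i.+1 `|` (G i.+1).2)).
    by exists t.
  by split => h; apply: nb; [left|right].
(* Each of the [n] stages contributes two events of probability at most [delta / (2 * n)]. *)
have Pbad : (P bad <= delta%:E)%E.
  apply: (le_trans (probability_bigsetU_le _ _ (fun i _ => mFG i))).
  apply: (@le_trans _ _ (\sum_(i < n) (delta / n%:R)%:E)%E).
    apply: lee_sum => i _.
    have [mF PF _] := hF i.+1 (ltn_ord i).
    have [_ _ mG PG _] := hG i.+1 (ltn_ord i).
    apply: (@le_trans _ _ (P (F i.+1) + P (G i.+1).2)%E); first exact: measureU2.
    apply: (le_trans (leeD PF PG)); rewrite -EFinD lee_fin.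
    rewrite le_eqVlt; apply/orP; left; apply/eqP; field.
    by rewrite gt_eqF.
  rewrite sumEFin lee_fin sumr_const card_ord -[_ *+ n]mulr_natr divfK//.
  by rewrite gt_eqF.
rewrite -[M]setCK probability_setC; last exact: measurableC.
rewrite EFinB; apply: leeB => //; apply: le_trans Pbad.
by apply: le_measure => //; rewrite inE//; exact: measurableC.
Qed.
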